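(* Let $\alpha,\beta>-1$ and let $m$ and $n$ be two positive integers with $n\ge m$. The coefficients $\rho_{j,n}^{m;(\alpha,\beta)}$, $0\le j\le m+n+1$, in the expansion $$\int_{-1}^{x+1}P_m^{(\alpha,\beta)}(x-t)P_n^{(\alpha,\beta)}(t)\,dt=\sum_{j=0}^{m+n+1}\rho_{j,n}^{m;(\alpha,\beta)}P_j^{(\alpha,\beta)}(x+1)$$ can be expressed as $$\rho_{j,n}^{m;(\alpha,\beta)}=\sum_{\nu=\max(1,|j-n|)}^{m+1}\varpi_{j,\nu}^{m,n}(\alpha,\beta)\quad\text{for } j\ge\max(m+1,n-m-1),$$ $$\rho_{j,n}^{m;(\alpha,\beta)}=0\quad\text{for } m+1\le j\le n-m-2,\ \text{if } n\ge2m+3,$$ $$\rho_{j,n}^{m;(\alpha,\beta)}=\sum_{\nu=1}^j\varpi_{j,\nu}^{n,m}(\alpha,\beta)+\sum_{\nu=j+1}^{n+1}d_{\nu,j,n}^m(\alpha,\beta)\quad\text{for }0\le j\le m,$$ where $$\varpi_{j,\nu}^{m,n}(\alpha,\beta)=\frac{2(-1)^{m+\nu-1}(j-\nu+\alpha+1)_{n-j+\nu}(n+\alpha+\beta+1)_{j-\nu}(\beta+\nu)_{m-\nu+1}(m+\alpha+\beta+1)_{\nu-1}}{(j+\alpha+\beta+1)_j\,(m+1-\nu)!\,(n-j+\nu)!}\;{}_3F_2\!\left({j-n-\nu,\ j+\alpha+1,\ n+j-\nu+\alpha+\beta+1\atop j-\nu+\alpha+1,\ 2j+\alpha+\beta+2};1\right)$$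 (with $\varpi_{j,\nu}^{n,m}$ obtained by interchanging $m$ and $n$), and $$d_{\nu,j,n}^m(\alpha,\beta)=\frac{2(-1)^{m+n+1+\nu}(\alpha+\beta+2j+1)(\beta+\nu)(j+\beta+1)_{m-j}(\beta+1)_n(n+1+\alpha+\beta)_{\nu-1}}{m!\,(n+1-\nu)!\,(\nu-j)!\,(j+\alpha+\beta+1)_{\nu+1}}\;{}_4F_3\!\left({1,\ -m,\ \beta+\nu+1,\ m+\alpha+\beta+1\atop \nu-j+1,\ \beta+1,\ j+\alpha+\beta+\nu+2};1\right).$$
   Context: $(z)_0=1$ and $(z)_N=\prod_{\sigma=0}^{N-1}(z+\sigma)$ for $N\ge1$. The generalized hypergeometric series is ${}_pF_q\left({a_1,\ldots,a_p\atop b_1,\ldots,b_q};x\right)=\sum_{N\ge0}\frac{(a_1)_N\cdots(a_p)_N}{(b_1)_N\cdots(b_q)_N}\frac{x^N}{N!}$. Jacobi polynomials are normalized by $P_n^{(\alpha,\beta)}(x)=\frac{(\alpha+1)_n}{n!}\,{}_2F_1\left({-n,\ n+\alpha+\beta+1\atop\alpha+1};\frac{1-x}{2}\right)$. Empty sums are zero. When $\alpha+\beta=-1$ and $j=0$, the factor $(\alpha+\beta+2j+1)/(j+\alpha+\beta+1)_{\nu+1}$ in $d_{\nu,j,n}^m$ is of the form $0/0$ and is understood as its limiting value $1/(\alpha+\beta+2)_\nu=1/\nu!$. *)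

(* Defs.v *)
From Stdlib Require Import Reals ZArith List.
From Coquelicot Require Import Coquelicot.
Import ListNotations.
Open Scope R_scope.

Fixpoint poch (z : R) (N : nat) : R :=
  match N with
  | O => 1
  | S N' => poch z N' * (z + INR N')
  end.

Definition poch_prod (l : list R) (N : nat) : R :=
  fold_right (fun c acc => poch c N * acc) 1 l.

(* The numerator parameters are [a] and the denominator parameters [b].  When
   an element of [a] is a nonpositive integer all but finitely many terms
   vanish and [Series] is the finite sum. *)
Definition hypergeom (a b : list R) (x : R) : R :=
  Series (fun N => poch_prod a N / poch_prod b N * (x ^ N / INR (fact N))).

Definition jacobi (n : nat) (alpha beta x : R) : R :=
  poch (alpha + 1) n / INR (fact n)
  * hypergeom [- INR n; INR n + alpha + beta + 1] [alpha + 1] ((1 - x) / 2).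

Definition abs_diff (j n : nat) : nat := Z.abs_nat (Z.of_nat j - Z.of_nat n).

(* Only meaningful for 1 <= nu <= m + 1, nu <= j and j <= n + nu, where none of
   the natural-number subtractions below truncates. *)
Definition varpi (m n j nu : nat) (alpha beta : R) : R :=
  2 * (-1) ^ (m + nu - 1)
  * poch (INR j - INR nu + alpha + 1) (n + nu - j)
  * poch (INR n + alpha + beta + 1) (j - nu)
  * poch (beta + INR nu) (m + 1 - nu)
  * poch (INR m + alpha + beta + 1) (nu - 1)
  / (poch (INR j + alpha + beta + 1) j
     * INR (fact (m + 1 - nu)) * INR (fact (n + nu - j)))
  * hypergeom
      [INR j - INR n - INR nu; INR j + alpha + 1;
       INR n + INR j - INR nu + alpha + beta + 1]
      [INR j - INR nu + alpha + 1; 2 * INR j + alpha + beta + 2]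
      1.

(* (alpha+beta+2j+1) / (j+alpha+beta+1)_{nu+1}, which has the form 0/0 when
   j = 0 and alpha + beta = -1 and is then replaced by its limiting value. *)
Definition dratio (nu j : nat) (alpha beta : R) : R :=
  match j, Req_EM_T (alpha + beta) (-1) with
  | O, left _ => 1 / poch (alpha + beta + 2) nu
  | _, _ => (alpha + beta + 2 * INR j + 1)
            / poch (INR j + alpha + beta + 1) (nu + 1)
  end.

(* Only meaningful for j <= m and j + 1 <= nu <= n + 1, where none of the
   natural-number subtractions below truncates. *)
Definition dcoef (m n nu j : nat) (alpha beta : R) : R :=
  2 * (-1) ^ (m + n + 1 + nu)
  * dratio nu j alpha beta
  * (beta + INR nu)
  * poch (INR j + beta + 1) (m - j)
  * poch (beta + 1) n
  * poch (INR n + 1 + alpha + beta) (nu - 1)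
  / (INR (fact m) * INR (fact (n + 1 - nu)) * INR (fact (nu - j)))
  * hypergeom
      [1; - INR m; beta + INR nu + 1; INR m + alpha + beta + 1]
      [INR nu - INR j + 1; beta + 1; INR j + alpha + beta + INR nu + 2]
      1.

(* [RInt] is the oriented integral, so the identity is required at every real
   [x], including x + 1 < -1. *)
Definition is_convolution_expansion
    (alpha beta : R) (m n : nat) (rho : nat -> R) : Prop :=
  forall x : R,
    RInt (fun t => jacobi m alpha beta (x - t) * jacobi n alpha beta t)
         (-1) (x + 1)
    = sum_n_m (fun j => rho j * jacobi j alpha beta (x + 1)) 0 (m + n + 1).

(* Main.v *)
Require Import Defs.
From Stdlib Require Import Reals Lra Lia List Factorial.
From Coquelicot Require Import Coquelicot.
Import ListNotations.
Open Scope R_scope.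

(** Expanding [P_m] in powers of the distance to the left endpoint turns the
    convolution into a linear combination of the [nu]-fold antiderivatives of
    [P_n] from [-1], [1 <= nu <= m + 1]; by symmetry [m] and [n] may be
    exchanged.  Inserting the expansion of each power in Jacobi polynomials gives
    the [j]-th coefficient of such an antiderivative as the [4F3] of [dcoef].
    When [nu <= j] one may instead antidifferentiate from [x = 1], since the two
    antiderivatives differ by a polynomial of degree less than [nu]; this gives
    the [3F2] of [varpi].  If moreover [j + nu < n], the latter coefficient is an
    [n]-th finite difference of a polynomial of degree [n - nu - 1], hence zero. *)

(** * Finite sums *)

Lemma sum_scal_l (c : R) (f : nat -> R) (n : nat) :
  sum_f_R0 (fun k => c * f k) n = c * sum_f_R0 f n.
Proof. induction n as [|n IH]; simpl; [|rewrite IH]; ring. Qed.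

Lemma sum_switch (f : nat -> nat -> R) (m n : nat) :
  sum_f_R0 (fun i => sum_f_R0 (f i) n) m
  = sum_f_R0 (fun j => sum_f_R0 (fun i => f i j) m) n.
Proof.
induction m as [|m IH]; [reflexivity|].
simpl; rewrite IH, <- plus_sum; reflexivity.
Qed.

Lemma sum_eq0 (f : nat -> R) (n : nat) :
  (forall k, (k <= n)%nat -> f k = 0) -> sum_f_R0 f n = 0.
Proof.
intros H; induction n as [|n IH].
- simpl; apply H; lia.
- rewrite tech5, IH, H by auto; ring.
Qed.

Lemma sum_split_first (f : nat -> R) (n : nat) :
  sum_f_R0 f (S n) = f O + sum_f_R0 (fun k => f (S k)) n.
Proof.
induction n as [|n IH].
- simpl; ring.
- rewrite tech5, IH, tech5; ring.
Qed.

Lemma sum_shift (f : nat -> R) (d n : nat) :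
  (forall k, (k < d)%nat -> f k = 0) ->
  sum_f_R0 f (d + n) = sum_f_R0 (fun k => f (d + k)%nat) n.
Proof.
revert f; induction d as [|d IH]; intros f H; [reflexivity|].
simpl Nat.add at 1; rewrite sum_split_first, H, IH by (intros; try apply H; lia).
rewrite Rplus_0_l; reflexivity.
Qed.

Lemma sum_extend (f : nat -> R) (n N : nat) :
  (n <= N)%nat -> (forall k, (n < k)%nat -> f k = 0) -> sum_f_R0 f N = sum_f_R0 f n.
Proof.
intros Hn H; induction Hn as [|N Hn IH]; [reflexivity|].
rewrite tech5, IH, H by lia; ring.
Qed.

Lemma sum_single (f : nat -> R) (i n : nat) :
  (i <= n)%nat -> (forall k, k <> i -> f k = 0) -> sum_f_R0 f n = f i.
Proof.
intros Hi H; rewrite (sum_extend f i n) by (auto; intros; apply H; lia).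
destruct i as [|i]; [reflexivity|].
rewrite tech5, sum_eq0 by (intros; apply H; lia); ring.
Qed.

(** * Pochhammer symbols, factorials and terminating series *)

Lemma poch_add (z : R) (p q : nat) :
  poch z (p + q) = poch z p * poch (z + INR p) q.
Proof.
induction q as [|q IH].
- rewrite Nat.add_0_r; simpl; ring.
- rewrite Nat.add_succ_r; simpl; rewrite IH, plus_INR; ring.
Qed.

Lemma poch_succ_l (z : R) (n : nat) : poch z (S n) = z * poch (z + 1) n.
Proof. change (S n) with (1 + n)%nat; rewrite poch_add; simpl; ring. Qed.

Lemma poch_pos (z : R) (n : nat) : 0 < z -> 0 < poch z n.
Proof.
intros Hz; induction n as [|n IH]; simpl; [lra|].
apply Rmult_lt_0_compat; [exact IH|]; pose proof (pos_INR n); lra.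
Qed.

Lemma poch_neq0 (z : R) (n : nat) : 0 < z -> poch z n <> 0.
Proof. intros Hz; apply Rgt_not_eq, poch_pos, Hz. Qed.

Lemma poch_opp_gt (r j : nat) : (r < j)%nat -> poch (- INR r) j = 0.
Proof.
intros H; replace j with (S r + (j - S r))%nat by lia.
rewrite poch_add; simpl; ring.
Qed.

(** Up to sign the factors on the left are [p + 1, ..., p + j]. This is the bridge between symbols
    at negative integers and quotients of factorials, kept free of division. *)
Lemma poch_opp_fact (p j : nat) :
  poch (- INR (p + j)) j * INR (fact p) = (-1) ^ j * INR (fact (p + j)).
Proof.
induction j as [|j IH].
- rewrite Nat.add_0_r; simpl; ring.
- rewrite poch_succ_l, Nat.add_succ_r, S_INR.
  replace (- (INR (p + j) + 1) + 1) with (- INR (p + j)) by ring.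
  rewrite Rmult_assoc, IH, fact_simpl, mult_INR, S_INR; simpl; ring.
Qed.

Lemma poch_opp_neq0 (r j : nat) : (j <= r)%nat -> poch (- INR r) j <> 0.
Proof.
intros H E; pose proof (poch_opp_fact (r - j) j) as P.
rewrite Nat.sub_add, E, Rmult_0_l in P by exact H.
symmetry in P; apply Rmult_integral in P as [P|P].
- revert P; apply pow_nonzero; lra.
- revert P; apply INR_fact_neq_0.
Qed.

Lemma fact_add (p q : nat) :
  INR (fact (p + q)) = INR (fact p) * poch (INR p + 1) q.
Proof.
induction q as [|q IH].
- rewrite Nat.add_0_r; simpl; ring.
- rewrite Nat.add_succ_r, fact_simpl, mult_INR, S_INR, IH, plus_INR; simpl; ring.
Qed.

Lemma pow_m1_sq (j : nat) : (-1) ^ j * (-1) ^ j = 1.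
Proof. rewrite <- Rpow_mult_distr; replace (-1 * -1) with 1 by ring; apply pow1. Qed.

(** The partial sums are constant from index [N] on, hence so is their limit. Every series below has
    a parameter [- INR n] and becomes a finite sum this way. *)
Lemma hypergeom_terminating (a b : list R) (x : R) (N : nat) :
  (forall k, (N < k)%nat -> poch_prod a k = 0) ->
  hypergeom a b x
  = sum_f_R0 (fun k => poch_prod a k / poch_prod b k * (x ^ k / INR (fact k))) N.
Proof.
intros H; apply is_series_unique.
apply (filterlim_ext_loc (fun _ =>
  sum_f_R0 (fun k => poch_prod a k / poch_prod b k * (x ^ k / INR (fact k))) N));
  [|apply filterlim_const].
exists N; intros k Hk; rewrite sum_n_Reals; symmetry; apply sum_extend; [exact Hk|].
intros i Hi; rewrite H by exact Hi; unfold Rdiv; ring.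
Qed.

(** * The quotient [(lam + 2 j) / (j + lam)_(r + 1)] and its summation *)

(** At [j = 0] the common factor [lam] is cancelled in advance, so the value is also right for
    [lam = 0], that is [alpha + beta = -1]. *)
Definition jac_ratio (lam : R) (r j : nat) : R :=
  match j with
  | O => / poch (lam + 1) r
  | S _ => (lam + 2 * INR j) / poch (INR j + lam) (r + 1)
  end.

(** At the exceptional point both sides are the limiting value; elsewhere with [j = 0] the factor
    [a + b + 1] is nonzero and cancels. *)
Lemma dratio_jac_ratio (nu j : nat) (a b : R) :
  -1 < a -> -1 < b -> dratio nu j a b = jac_ratio (a + b + 1) nu j.
Proof.
intros Ha Hb; unfold dratio, jac_ratio.
destruct j as [|j]; [destruct (Req_EM_T (a + b) (-1)) as [E|E]|].
- replace (a + b + 1 + 1) with (a + b + 2) by ring; unfold Rdiv; ring.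
- replace (nu + 1)%nat with (S nu) by lia; rewrite poch_succ_l; simpl INR.
  replace (0 + a + b + 1) with (a + b + 1) by ring.
  field; split; [apply poch_neq0; lra|lra].
- f_equal; [ring|f_equal; ring].
Qed.

Lemma jac_ratio_shift (lam : R) (r j N : nat) :
  -1 < lam ->
  jac_ratio lam (r + N) j = jac_ratio lam r j / poch (INR j + lam + INR r + 1) N.
Proof.
intros Hl; unfold jac_ratio; destruct j as [|j].
- rewrite poch_add; simpl INR.
  replace (0 + lam + INR r + 1) with (lam + 1 + INR r) by ring.
  field; pose proof (pos_INR r); split; apply poch_neq0; lra.
- replace (r + N + 1)%nat with (r + 1 + N)%nat by lia; rewrite poch_add, (plus_INR r 1).
  replace (INR (S j) + lam + (INR r + INR 1)) with (INR (S j) + lam + INR r + 1)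
    by (change (INR 1) with 1; ring).
  rewrite S_INR; pose proof (pos_INR r); pose proof (pos_INR j).
  field; split; apply poch_neq0; lra.
Qed.

(** For [r = j] the numerator [lam + 2 j] is the last factor of the denominator. *)
Lemma jac_ratio_diag (lam : R) (j : nat) :
  -1 < lam -> jac_ratio lam j j = / poch (INR j + lam) j.
Proof.
intros Hl; unfold jac_ratio; destruct j as [|j].
- reflexivity.
- rewrite poch_add.
  change (poch (INR (S j) + lam + INR (S j)) 1) with (1 * (INR (S j) + lam + INR (S j) + 0)).
  rewrite S_INR; pose proof (pos_INR j).
  field; split; [|lra]; apply poch_neq0; lra.
Qed.

(* Gosper telescoping: the summand [F i] equals [G (i + 1) - G i], where [G i] is
   the right-hand side with [j + 1] replaced by [i]. *)
Lemma jac_ratio_partial_sum (lam : R) (k r j : nat) :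
  -1 < lam -> (k < r)%nat ->
  sum_f_R0 (fun i => poch (- INR r) i / INR (fact i) * jac_ratio lam r i
                  * (poch (- INR i) k * poch (INR i + lam) k)) j
  = - / (INR r - INR k) * (INR j + 1 - INR k) * (INR j + lam + INR r + 1)
    * (poch (- INR r) (S j) / INR (fact (S j)) / poch (INR (S j) + lam) (r + 1)
       * (poch (- INR (S j)) k * poch (INR (S j) + lam) k)).
Proof.
intros Hl Hk.
assert (Hrk : INR r - INR k <> 0) by (apply lt_INR in Hk; lra).
induction j as [|j IH].
- cbn [sum_f_R0]; destruct k as [|k].
  + simpl; replace (r + 1)%nat with (S r) by lia; simpl.
    replace (1 + lam) with (lam + 1) by ring.
    assert (poch (lam + 1) r <> 0) by (apply poch_neq0; lra).
    pose proof (pos_INR r); simpl in Hrk.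
    field; repeat split; lra.
  (* For positive order the left side vanishes. The right side vanishes too: through the factor
     [INR j + 1 - INR k] at order 1, through [(-1)_k] at higher order. *)
  + rewrite (poch_opp_gt 0 (S k)) by lia.
    destruct k as [|k].
    * simpl; ring.
    * rewrite (poch_opp_gt 1 (S (S k))) by lia; ring.
- rewrite tech5, IH; clear IH.
  assert (Hr1 : INR (S j) + 1 = INR (S (S j))) by (rewrite (S_INR (S j)); ring).
  assert (Hj := pos_INR j); assert (Hr := pos_INR r).
  (* These three relations compare the symbols at [j + 2] and [j + 1]. They are cross-multiplied; in
     [E1] the factor [j + 2 - k] may be zero and cannot be divided out. *)
  assert (E1 : poch (- INR (S (S j))) k * (INR j + 2 - INR k)
               = poch (- INR (S j)) k * (INR j + 2)).
  { destruct k as [|k]; [simpl; ring|].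
    rewrite poch_succ_l; replace (- INR (S (S j)) + 1) with (- INR (S j))
      by (rewrite !S_INR; ring).
    change (poch (- INR (S j)) (S k)) with (poch (- INR (S j)) k * (- INR (S j) + INR k)).
    rewrite !S_INR; ring. }
  assert (E2 : (INR (S j) + lam) * poch (INR (S (S j)) + lam) k
               = (INR (S j) + lam + INR k) * poch (INR (S j) + lam) k).
  { replace (INR (S (S j)) + lam) with (INR (S j) + lam + 1) by (rewrite <- Hr1; ring).
    rewrite <- poch_succ_l; simpl; ring. }
  assert (E3 : (INR (S j) + lam) * poch (INR (S (S j)) + lam) (r + 1)
               = (INR (S j) + lam + INR r + 1) * poch (INR (S j) + lam) (r + 1)).
  { replace (INR (S (S j)) + lam) with (INR (S j) + lam + 1) by (rewrite <- Hr1; ring).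
    rewrite <- poch_succ_l; simpl; rewrite plus_INR; change (INR 1) with 1; ring. }
  change (jac_ratio lam r (S j))
    with ((lam + 2 * INR (S j)) / poch (INR (S j) + lam) (r + 1)).
  assert (N1 : poch (INR (S j) + lam) (r + 1) <> 0)
    by (apply poch_neq0; rewrite S_INR; lra).
  assert (N2 : poch (INR (S (S j)) + lam) (r + 1) <> 0)
    by (apply poch_neq0; rewrite !S_INR; lra).
  change (poch (- INR r) (S (S j))) with (poch (- INR r) (S j) * (- INR r + INR (S j))).
  rewrite (fact_simpl (S j)), mult_INR.
  assert (NF := INR_fact_neq_0 (S j)).
  set (X := poch (INR (S j) + lam) (r + 1)) in *.
  set (Y := poch (INR (S (S j)) + lam) (r + 1)) in *.
  set (U := poch (INR (S j) + lam) k) in *.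
  set (V := poch (INR (S (S j)) + lam) k) in *.
  set (A := poch (- INR (S j)) k) in *.
  set (B := poch (- INR (S (S j))) k) in *.
  set (c := poch (- INR r) (S j)); set (f := INR (fact (S j))) in *.
  rewrite !S_INR in *.
  set (J := INR j) in *; set (K := INR k) in *; set (r' := INR r) in *.
  assert (Y = (J + 1 + lam + r' + 1) * X / (J + 1 + lam)) as -> by
    (rewrite <- E3; field; lra).
  assert (V = (J + 1 + lam + K) * U / (J + 1 + lam)) as -> by
    (rewrite <- E2; field; lra).
  (* The factor [J + 2 - K] is brought next to [B], since [E1] only determines their product. *)
  replace (- / (r' - K) * (J + 1 + 1 - K) * (J + 1 + lam + r' + 1) *
    (c * (- r' + (J + 1)) / ((J + 1 + 1) * f) / ((J + 1 + lam + r' + 1) * X / (J + 1 + lam)) *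
    (B * ((J + 1 + lam + K) * U / (J + 1 + lam)))))
  with (- / (r' - K) * (J + 1 + lam + r' + 1) *
    (c * (- r' + (J + 1)) / ((J + 1 + 1) * f) / ((J + 1 + lam + r' + 1) * X / (J + 1 + lam)) *
    (B * (J + 2 - K) * ((J + 1 + lam + K) * U / (J + 1 + lam))))) by
   (field; repeat split; lra).
  rewrite E1; field; repeat split; lra.
Qed.

(** Up to normalization this says that two triangular matrices are inverse: Jacobi polynomials in
    powers, and powers in Jacobi polynomials. Below the diagonal the telescoped sum ends in
    [(-r)_(N+1) = 0]; on it one term survives; above it each term has a vanishing factor. *)
Lemma jac_ratio_sum (lam : R) (k r N : nat) :
  -1 < lam -> (r <= N)%nat ->
  sum_f_R0 (fun i => poch (- INR r) i / INR (fact i) * jac_ratio lam r i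
                  * (poch (- INR i) k * poch (INR i + lam) k)) N
  = if Nat.eq_dec k r then INR (fact r) else 0.
Proof.
intros Hl HN; destruct (Nat.eq_dec k r) as [->|Hk].
- rewrite (sum_single _ r); [|exact HN|].
  2:{ intros i Hi; destruct (Nat.lt_ge_cases r i).
      - rewrite (poch_opp_gt r i) by assumption; unfold Rdiv; ring.
      - rewrite (poch_opp_gt i r) by lia; ring. }
  pose proof (poch_opp_fact 0 r) as P; simpl in P.
  rewrite Rmult_1_r in P; rewrite P, jac_ratio_diag by exact Hl.
  assert (poch (INR r + lam) r <> 0).
  { destruct r as [|r]; [simpl; lra|apply poch_neq0].
    rewrite S_INR; pose proof (pos_INR r); lra. }
  transitivity ((-1) ^ r * (-1) ^ r * INR (fact r)).
  + field; split; [assumption|apply INR_fact_neq_0].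
  + rewrite pow_m1_sq; ring.
- destruct (Nat.lt_ge_cases k r) as [H|H].
  + rewrite jac_ratio_partial_sum by assumption.
    rewrite (poch_opp_gt r (S N)) by lia; unfold Rdiv; ring.
  + apply sum_eq0; intros i Hi; destruct (Nat.lt_ge_cases r i).
    * rewrite (poch_opp_gt r i) by assumption; unfold Rdiv; ring.
    * rewrite (poch_opp_gt i k) by lia; ring.
Qed.

(** * Alternating binomial sums *)

(** Pascal's rule, because [(-n)_k / k!] is [(-1)^k] times the binomial coefficient. *)
Lemma poch_opp_succ (n k : nat) :
  poch (- INR (S n)) (S k) / INR (fact (S k))
  = poch (- INR n) (S k) / INR (fact (S k)) - poch (- INR n) k / INR (fact k).
Proof.
rewrite poch_succ_l, fact_simpl, mult_INR.
replace (- INR (S n) + 1) with (- INR n) by (rewrite S_INR; ring).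
simpl (poch (- INR n) (S k)); rewrite !S_INR.
pose proof (pos_INR k); field; split; [apply INR_fact_neq_0|lra].
Qed.

(** The terminating 2F1 sum at 1 multiplied by [(c)_n], which removes all denominators in [c]. After
    Pascal's rule the two sums combine termwise into [c - b] times the sum for [n] and [c + 1]. *)
Lemma chu_vandermonde (n : nat) (b c : R) :
  sum_f_R0 (fun k => poch (- INR n) k / INR (fact k) * poch b k
                     * poch (c + INR k) (n - k)) n
  = poch (c - b) n.
Proof.
revert c; induction n as [|n IH]; intros c; [simpl; field|].
set (g := fun k => poch (- INR n) k / INR (fact k) * poch b k
                   * poch (c + INR k) (S n - k)).
set (h := fun k => poch (- INR n) k / INR (fact k) * poch b (S k)
                   * poch (c + INR (S k)) (n - k)).
transitivity (sum_f_R0 g n + -1 * sum_f_R0 h n).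
- rewrite sum_split_first, <- sum_scal_l.
  rewrite <- (sum_extend g n (S n)); [|lia|].
  2:{ intros k Hk; unfold g; rewrite poch_opp_gt by exact Hk; unfold Rdiv; ring. }
  rewrite (sum_split_first g), Rplus_assoc, <- plus_sum; f_equal.
  apply sum_eq; intros k _; unfold g, h; rewrite poch_opp_succ.
  simpl (S n - S k)%nat; ring.
- rewrite <- sum_scal_l, <- plus_sum, poch_succ_l.
  replace (c - b + 1) with (c + 1 - b) by ring.
  rewrite <- IH, <- sum_scal_l; apply sum_eq; intros k Hk; unfold g, h.
  replace (S n - k)%nat with (S (n - k)) by lia.
  rewrite (poch_succ_l (c + INR k)), S_INR; simpl (poch b (S k)).
  replace (c + INR k + 1) with (c + (INR k + 1)) by ring.
  replace (c + 1 + INR k) with (c + (INR k + 1)) by ring.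
  unfold Rdiv; ring.
Qed.

Lemma pow_one_minus (y : R) (k N : nat) :
  (k <= N)%nat ->
  (1 - y) ^ k = sum_f_R0 (fun i => poch (- INR k) i / INR (fact i) * y ^ i) N.
Proof.
intros Hk; rewrite (sum_extend _ k) by
  (auto; intros i Hi; rewrite poch_opp_gt by exact Hi; unfold Rdiv; ring).
clear N Hk; induction k as [|k IH]; [simpl; field|].
set (g := fun i => poch (- INR k) i / INR (fact i) * y ^ i) in *.
rewrite sum_split_first.
transitivity (sum_f_R0 g (S k) + - y * sum_f_R0 g k).
- rewrite (sum_extend g k) by
    (auto; intros i Hi; unfold g; rewrite poch_opp_gt by exact Hi; unfold Rdiv; ring).
  rewrite <- IH; simpl; ring.
- rewrite (sum_split_first g), <- sum_scal_l, Rplus_assoc, <- plus_sum; f_equal.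
  apply sum_eq; intros i _; unfold g; rewrite poch_opp_succ; simpl; ring.
Qed.

Lemma poch_reverse (z : R) (p : nat) :
  poch (- (z + INR p)) p = (-1) ^ p * poch (z + 1) p.
Proof.
induction p as [|p IH]; [simpl; ring|].
rewrite poch_succ_l, S_INR.
replace (- (z + (INR p + 1)) + 1) with (- (z + INR p)) by ring.
rewrite IH; simpl; ring.
Qed.

(** * Jacobi polynomials about either endpoint *)

(** The coefficient of [((1 - x) / 2)^k] in the [n]-th Jacobi polynomial. With [a] and [b] exchanged
    and the sign [(-1)^n] it becomes the coefficient of [((1 + x) / 2)^k]. *)
Definition jac_coef (a b : R) (n k : nat) : R :=
  poch (a + 1) n / INR (fact n)
  * (poch (- INR n) k * poch (INR n + a + b + 1) k / (poch (a + 1) k * INR (fact k))).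

Lemma jac_coef_gt (a b : R) (n k : nat) : (n < k)%nat -> jac_coef a b n k = 0.
Proof. intros H; unfold jac_coef; rewrite poch_opp_gt by exact H; unfold Rdiv; ring. Qed.

Lemma jacobi_sum (n : nat) (a b x : R) (N : nat) :
  -1 < a -> (n <= N)%nat ->
  jacobi n a b x = sum_f_R0 (fun k => jac_coef a b n k * ((1 - x) / 2) ^ k) N.
Proof.
intros Ha HN.
rewrite (sum_extend _ n) by (auto; intros; rewrite jac_coef_gt by assumption; ring).
unfold jacobi; rewrite (hypergeom_terminating _ _ _ n).
- rewrite <- sum_scal_l; apply sum_eq; intros k _; unfold jac_coef; simpl.
  assert (poch (a + 1) k <> 0) by (apply poch_neq0; lra).
  pose proof (INR_fact_neq_0 k); pose proof (INR_fact_neq_0 n).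
  field; auto.
- intros k Hk; simpl; rewrite poch_opp_gt by exact Hk; ring.
Qed.

(** The left side arises from expanding powers of [1 - y] in powers of [y]. Terms with [k < i]
    vanish; the others form a Chu-Vandermonde sum of length [p = n - i] whose value is a reversed
    Pochhammer symbol, whence the sign. *)
Lemma jac_coef_reflect (a b : R) (n i : nat) :
  -1 < a -> -1 < b ->
  sum_f_R0 (fun k => jac_coef a b n k * (poch (- INR k) i / INR (fact i))) n
  = (-1) ^ n * jac_coef b a n i.
Proof.
intros Ha Hb; destruct (Nat.lt_ge_cases n i) as [H|H].
{ rewrite jac_coef_gt by exact H; rewrite sum_eq0; [ring|].
  intros k Hk; rewrite (poch_opp_gt k i) by lia; unfold Rdiv; ring. }
replace n with (i + (n - i))%nat by lia; set (p := (n - i)%nat); clearbody p; clear H n.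
rewrite sum_shift by (intros k Hk; rewrite (poch_opp_gt k i) by exact Hk; unfold Rdiv; ring).
set (n := (i + p)%nat).
transitivity (poch (- INR n) i * poch (INR n + a + b + 1) i * (-1) ^ i
  / (INR (fact n) * INR (fact i))
  * sum_f_R0 (fun k => poch (- INR p) k / INR (fact k)
       * poch (INR n + a + b + 1 + INR i) k
       * poch (a + 1 + INR i + INR k) (p - k)) p).
- rewrite <- sum_scal_l; apply sum_eq; intros k Hk; unfold jac_coef.
  rewrite (poch_add (- INR n)), (poch_add (INR n + a + b + 1)).
  replace (- INR n + INR i) with (- INR p) by (unfold n; rewrite plus_INR; ring).
  assert (E : poch (a + 1) n
    = poch (a + 1) (i + k) * poch (a + 1 + INR i + INR k) (p - k)).
  { replace n with (i + k + (p - k))%nat by (unfold n; lia).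
    rewrite poch_add, plus_INR; f_equal; f_equal; ring. }
  pose proof (poch_opp_fact k i) as F; rewrite (Nat.add_comm k i) in F.
  assert (poch (a + 1) (i + k) <> 0) by (apply poch_neq0; lra).
  pose proof (INR_fact_neq_0 k); pose proof (INR_fact_neq_0 n).
  pose proof (INR_fact_neq_0 i); pose proof (INR_fact_neq_0 (i + k)).
  replace (poch (- INR (i + k)) i) with ((-1) ^ i * INR (fact (i + k)) / INR (fact k))
    by (rewrite <- F; field; assumption).
  rewrite E; field; auto.
- rewrite chu_vandermonde.
  replace (a + 1 + INR i - (INR n + a + b + 1 + INR i)) with (- (b + INR i + INR p))
    by (unfold n; rewrite plus_INR; ring).
  rewrite poch_reverse; unfold jac_coef.
  replace (poch (b + 1) n) with (poch (b + 1) i * poch (b + INR i + 1) p)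
    by (unfold n; rewrite poch_add; f_equal; f_equal; ring).
  replace (INR n + b + a + 1) with (INR n + a + b + 1) by ring.
  unfold n at 4; rewrite pow_add.
  assert (poch (b + 1) i <> 0) by (apply poch_neq0; lra).
  pose proof (INR_fact_neq_0 n); pose proof (INR_fact_neq_0 i).
  field; auto.
Qed.

Lemma jacobi_reflect (n : nat) (a b x : R) :
  -1 < a -> -1 < b -> jacobi n a b x = (-1) ^ n * jacobi n b a (- x).
Proof.
intros Ha Hb; rewrite (jacobi_sum n a b x n), (jacobi_sum n b a (- x) n) by auto.
transitivity (sum_f_R0 (fun k => sum_f_R0 (fun i => jac_coef a b n k
   * (poch (- INR k) i / INR (fact i)) * ((1 - - x) / 2) ^ i) n) n).
- apply sum_eq; intros k Hk.
  replace ((1 - x) / 2) with (1 - (1 - - x) / 2) by field.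
  rewrite (pow_one_minus _ k n), <- sum_scal_l by exact Hk.
  apply sum_eq; intros i _; ring.
- rewrite sum_switch, <- sum_scal_l; apply sum_eq; intros i Hi.
  rewrite <- Rmult_assoc, <- jac_coef_reflect by assumption.
  rewrite (Rmult_comm _ (((1 - - x) / 2) ^ i)), <- sum_scal_l.
  apply sum_eq; intros k _; ring.
Qed.

(** * Powers in the Jacobi basis *)

Definition pow_coef (a b : R) (r j : nat) : R :=
  poch (- INR r) j * poch (a + 1) r / poch (a + 1) j * jac_ratio (a + b + 1) r j.

Lemma pow_coef_gt (a b : R) (r j : nat) : (r < j)%nat -> pow_coef a b r j = 0.
Proof. intros H; unfold pow_coef; rewrite poch_opp_gt by exact H; unfold Rdiv; ring. Qed.

Lemma pow_right_jacobi (a b x : R) (r N : nat) :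
  -1 < a -> -1 < b -> (r <= N)%nat ->
  ((1 - x) / 2) ^ r = sum_f_R0 (fun j => pow_coef a b r j * jacobi j a b x) N.
Proof.
intros Ha Hb Hr; set (y := (1 - x) / 2).
transitivity (sum_f_R0 (fun k => sum_f_R0 (fun j =>
  pow_coef a b r j * jac_coef a b j k * y ^ k) N) N).
(* In powers of [y] only exponent [r] may survive: the Kronecker delta of [jac_ratio_sum] selects
   it, and its value [r!] cancels the factorial below. *)
- transitivity (sum_f_R0 (fun k => poch (a + 1) r / (poch (a + 1) k * INR (fact k))
     * (if Nat.eq_dec k r then INR (fact r) else 0) * y ^ k) N).
  + rewrite (sum_single _ r); [|exact Hr|].
    * destruct (Nat.eq_dec r r); [|tauto].
      assert (poch (a + 1) r <> 0) by (apply poch_neq0; lra).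
      field; split; [apply INR_fact_neq_0|assumption].
    * intros k Hk; destruct (Nat.eq_dec k r); [tauto|ring].
  + apply sum_eq; intros k Hk.
    rewrite <- (jac_ratio_sum (a + b + 1) k r N) by (auto; lra).
    rewrite Rmult_assoc, (Rmult_comm (sum_f_R0 _ _)), <- Rmult_assoc, <- sum_scal_l.
    apply sum_eq; intros j _; unfold pow_coef, jac_coef.
    replace (INR j + a + b + 1) with (INR j + (a + b + 1)) by ring.
    assert (poch (a + 1) j <> 0) by (apply poch_neq0; lra).
    assert (poch (a + 1) k <> 0) by (apply poch_neq0; lra).
    pose proof (INR_fact_neq_0 j); pose proof (INR_fact_neq_0 k).
    field; auto.
- rewrite sum_switch; apply sum_eq; intros j Hj.
  rewrite (jacobi_sum j a b x N), <- sum_scal_l by auto.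
  apply sum_eq; intros k _; fold y; ring.
Qed.

Lemma pow_left_jacobi (a b x : R) (r N : nat) :
  -1 < a -> -1 < b -> (r <= N)%nat ->
  ((1 + x) / 2) ^ r
  = sum_f_R0 (fun j => (-1) ^ j * pow_coef b a r j * jacobi j a b x) N.
Proof.
intros Ha Hb Hr.
replace ((1 + x) / 2) with ((1 - - x) / 2) by field.
rewrite (pow_right_jacobi b a (- x) r N) by assumption.
apply sum_eq; intros j _; rewrite (jacobi_reflect j a b x) by assumption.
transitivity ((-1) ^ j * (-1) ^ j * (pow_coef b a r j * jacobi j b a (- x)));
  [rewrite pow_m1_sq|]; ring.
Qed.

(** * Linear independence of the Jacobi polynomials *)

(* Eliminating the top coefficient between the values at [x] and [2 x]. *)
Lemma sum_pow_eq0 (c : nat -> R) (N : nat) :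
  (forall x, sum_f_R0 (fun k => c k * x ^ k) N = 0) ->
  forall k, (k <= N)%nat -> c k = 0.
Proof.
revert c; induction N as [|N IH]; intros c H k Hk.
- replace k with O by lia; rewrite <- (H 0); simpl; ring.
- assert (Hlow : forall i, (i <= N)%nat -> c i = 0).
  { intros i Hi.
    assert (E : c i * (2 ^ S N - 2 ^ i) = 0).
    { apply (IH (fun i => c i * (2 ^ S N - 2 ^ i))); [|exact Hi]; intros x.
      transitivity (2 ^ S N * sum_f_R0 (fun k => c k * x ^ k) (S N)
        + -1 * sum_f_R0 (fun k => c k * (2 * x) ^ k) (S N)); [|rewrite !H; ring].
      rewrite <- !sum_scal_l, <- plus_sum, tech5, <- (Rplus_0_r (sum_f_R0 _ N)).
      f_equal; [apply sum_eq; intros j _|]; rewrite Rpow_mult_distr; ring. }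
    assert (2 ^ i < 2 ^ S N) by (apply Rlt_pow; [lra|lia]).
    apply Rmult_integral in E as [E|E]; [exact E|lra]. }
  destruct (Nat.eq_dec k (S N)) as [->|]; [|apply Hlow; lia].
  specialize (H 1); rewrite tech5, sum_eq0, pow1 in H; [lra|].
  intros i Hi; rewrite Hlow by exact Hi; ring.
Qed.

Lemma jac_coef_diag_neq0 (a b : R) (n : nat) :
  -1 < a -> -1 < b -> jac_coef a b n n <> 0.
Proof.
intros Ha Hb; unfold jac_coef.
assert (poch (a + 1) n <> 0) by (apply poch_neq0; lra).
assert (poch (- INR n) n <> 0) by (apply poch_opp_neq0; lia).
(* For [n = 0] the base may be negative or zero, but the product is empty; for [n] positive the base
   is positive. *)
assert (poch (INR n + a + b + 1) n <> 0).
{ destruct n as [|n]; [simpl; lra|apply poch_neq0].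
  rewrite S_INR; pose proof (pos_INR n); lra. }
pose proof (INR_fact_neq_0 n).
repeat apply Rmult_integral_contrapositive_currified; auto;
  apply Rinv_neq_0_compat; auto.
Qed.

(** The degree of the [j]-th polynomial is exactly [j], so the top power isolates the last
    coefficient, and induction removes the rest. *)
Lemma jacobi_free (a b : R) (c : nat -> R) (N : nat) :
  -1 < a -> -1 < b ->
  (forall x, sum_f_R0 (fun j => c j * jacobi j a b x) N = 0) ->
  forall j, (j <= N)%nat -> c j = 0.
Proof.
intros Ha Hb; induction N as [|N IH]; intros H.
- intros j Hj; replace j with O by lia; specialize (H 0); simpl in H.
  rewrite (jacobi_sum 0 a b 0 0) in H by auto.
  pose proof (jac_coef_diag_neq0 a b 0 Ha Hb) as Hd; simpl in H.
  rewrite Rmult_1_r in H; apply Rmult_integral in H as [H|H]; tauto.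
- assert (Htop : c (S N) = 0).
  { assert (E : sum_f_R0 (fun j => c j * jac_coef a b j (S N)) (S N) = 0).
    { apply (sum_pow_eq0 (fun k => sum_f_R0 (fun j => c j * jac_coef a b j k) (S N)) (S N));
        [|lia]; intros y.
      (* This argument is chosen so that [(1 - x) / 2] is [y]. *)
      rewrite <- (H (1 - 2 * y)).
      transitivity (sum_f_R0 (fun k => sum_f_R0 (fun j =>
        c j * jac_coef a b j k * y ^ k) (S N)) (S N)).
      - apply sum_eq; intros k _; rewrite Rmult_comm, <- sum_scal_l.
        apply sum_eq; intros j _; ring.
      - rewrite sum_switch; apply sum_eq; intros j Hj.
        rewrite (jacobi_sum j a b _ (S N)), <- sum_scal_l by auto.
        replace ((1 - (1 - 2 * y)) / 2) with y by field.
        apply sum_eq; intros k _; ring. }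
    rewrite tech5, sum_eq0, Rplus_0_l in E;
      [|intros j Hj; rewrite jac_coef_gt by lia; ring].
    pose proof (jac_coef_diag_neq0 a b (S N) Ha Hb).
    apply Rmult_integral in E as [E|E]; tauto. }
  assert (Hlow : forall j, (j <= N)%nat -> c j = 0).
  { apply IH; intros x; rewrite <- (H x), tech5, Htop; ring. }
  intros j Hj; destruct (Nat.eq_dec j (S N)) as [->|]; [exact Htop|apply Hlow; lia].
Qed.

Lemma jacobi_coef_unique (a b : R) (c d : nat -> R) (N : nat) :
  -1 < a -> -1 < b ->
  (forall x, sum_f_R0 (fun j => c j * jacobi j a b x) N
             = sum_f_R0 (fun j => d j * jacobi j a b x) N) ->
  forall j, (j <= N)%nat -> c j = d j.
Proof.
intros Ha Hb H j Hj; apply Rminus_diag_uniq.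
apply (jacobi_free a b (fun j => c j - d j) N Ha Hb); [|exact Hj]; intros x.
rewrite <- (Rminus_diag_eq _ _ (H x)); unfold Rminus.
rewrite <- (Rmult_1_l (sum_f_R0 (fun j => d j * _) N)), Ropp_mult_distr_l.
rewrite <- sum_scal_l, <- plus_sum; apply sum_eq; intros i _; ring.
Qed.

(** * Finite differences of polynomials *)

(** Polynomials of degree at most [d] in [k], given as products of affine factors. Pochhammer
    symbols have this shape, and differences can be taken one factor at a time. *)
Fixpoint linear_product (d : nat) (g : nat -> R) : Prop :=
  match d with
  | O => exists c, forall k, g k = c
  | S d' => exists s c h,
      linear_product d' h /\ forall k, g k = (s * INR k + c) * h k
  end.

Lemma linear_product_shift (d : nat) (g : nat -> R) :
  linear_product d g -> linear_product d (fun k => g (S k)).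
Proof.
revert g; induction d as [|d IH]; intros g; simpl.
- intros [c H]; exists c; auto.
- intros (s & c & h & Hh & E); exists s, (s + c), (fun k => h (S k)); split.
  + apply IH, Hh.
  + intros k; rewrite E, S_INR; ring.
Qed.

Lemma linear_product_poch (d e : nat) (s c : R) (g h : nat -> R) :
  linear_product d g -> (forall k, h k = g k * poch (s * INR k + c) e) ->
  linear_product (e + d) h.
Proof.
intros Hg; revert h; induction e as [|e IH]; intros h E.
- assert (forall k, h k = g k) as E' by (intros k; rewrite E; simpl; ring).
  clear E; destruct d as [|d]; simpl in *.
  + destruct Hg as [a Ha]; exists a; intros k; rewrite E'; apply Ha.
  + destruct Hg as (s1 & c1 & g1 & Hg & Ha); exists s1, c1, g1.
    split; [exact Hg|]; intros k; rewrite E'; apply Ha.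
- simpl; exists s, (c + INR e), (fun k => g k * poch (s * INR k + c) e); split.
  + apply IH; reflexivity.
  + intros k; rewrite E; simpl; ring.
Qed.

(* The left-hand side is the [n]-th difference of [g] at [0], up to sign. *)
Lemma finite_difference_eq0 (d n : nat) (g : nat -> R) :
  (d < n)%nat -> linear_product d g ->
  sum_f_R0 (fun k => poch (- INR n) k / INR (fact k) * g k) n = 0.
Proof.
revert n g; induction d as [|d IH]; intros n g Hd; simpl.
- intros [c E].
  transitivity (c * (1 - 1) ^ n).
  + rewrite (pow_one_minus 1 n n), <- sum_scal_l by auto.
    apply sum_eq; intros k _; rewrite E, pow1; ring.
  + replace (1 - 1) with 0 by ring; rewrite pow_i by lia; ring.
- intros (s & c & h & Hh & E); destruct n as [|n]; [lia|].
  (* Since [k (-(n+1))_k / k!] equals [-(n+1) (-n)_(k-1) / (k-1)!], the part [s * k] of the factor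
     lowers the order by one and shifts [h]. *)
  transitivity (c * sum_f_R0 (fun k => poch (- INR (S n)) k / INR (fact k) * h k) (S n)
    + - s * INR (S n)
      * sum_f_R0 (fun k => poch (- INR n) k / INR (fact k) * h (S k)) n).
  + rewrite !sum_split_first, Rmult_plus_distr_l, <- !sum_scal_l.
    rewrite E, Rplus_assoc, <- plus_sum; f_equal; [simpl; ring|].
    apply sum_eq; intros k _; rewrite E, fact_simpl, mult_INR, poch_succ_l.
    replace (- INR (S n) + 1) with (- INR n) by (rewrite S_INR; ring).
    pose proof (INR_fact_neq_0 k); pose proof (pos_INR k); rewrite !S_INR.
    field; split; [assumption|lra].
  + rewrite (IH (S n) h), (IH n (fun k => h (S k))); [ring|lia| |lia|exact Hh].
    apply linear_product_shift, Hh.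
Qed.

(** * Iterated antiderivatives and their Jacobi coefficients *)

(* [antider_coef a b n nu j] is the coefficient of [jacobi j a b x] in the
   [nu]-fold antiderivative of [jacobi n a b] vanishing to order [nu] at [x = 1],
   with respect to the variable [(1 - x) / 2]. *)
Definition antider_coef (a b : R) (n nu j : nat) : R :=
  sum_f_R0 (fun k => jac_coef a b n k * (INR (fact k) / INR (fact (k + nu)))
                     * pow_coef a b (k + nu) j) n.

Lemma antider_coef_gt (a b : R) (n nu j : nat) :
  (n + nu < j)%nat -> antider_coef a b n nu j = 0.
Proof.
intros H; apply sum_eq0; intros k Hk; rewrite pow_coef_gt by lia; ring.
Qed.

Lemma antider_coef_lt (a b : R) (n nu j : nat) :
  -1 < a -> -1 < b -> (nu <= j)%nat -> (j + nu < n)%nat ->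
  antider_coef a b n nu j = 0.
Proof.
intros Ha Hb Hj Hn; unfold antider_coef.
(* Here [e] is the integer gap between [n + a + b + 1] and the denominator parameter [c]; it makes
   [(c + e)_k / (c)_k] a polynomial in [k] of degree [e]. *)
pose (e := (n - (j + nu + 1))%nat).
set (c := INR j + (a + b + 1) + INR nu + 1).
assert (Hc : 0 < c).
{ unfold c; pose proof (pos_INR j); pose proof (pos_INR nu).
  destruct j as [|j]; [|rewrite S_INR; pose proof (pos_INR j); lra].
  simpl INR; lra. }
assert (Hnc : INR n + a + b + 1 = c + INR e).
{ unfold c, e; rewrite minus_INR, !plus_INR by lia; simpl INR; ring. }
(* The three factors come from [(a+1)_(k+nu) / (a+1)_k], from [(-(k+nu))_j k! / (k+nu)!], and from
   [(c+e)_k / (c)_k], up to constants. Their degrees add up to [n - nu - 1]. *)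
pose (G := fun k => poch (1 * INR k + (a + 1)) nu * poch (-1 * INR k + 0) (j - nu)
                    * poch (1 * INR k + c) e).
transitivity (poch (a + 1) n / INR (fact n) * (-1) ^ nu / poch (a + 1) j
  * jac_ratio (a + b + 1) nu j / poch c e
  * sum_f_R0 (fun k => poch (- INR n) k / INR (fact k) * G k) n).
- rewrite <- sum_scal_l; apply sum_eq; intros k _; unfold jac_coef, pow_coef, G.
  rewrite Hnc, (Nat.add_comm k nu), jac_ratio_shift by lra.
  fold c.
  assert (E1 : poch (a + 1) (nu + k) = poch (a + 1) k * poch (1 * INR k + (a + 1)) nu).
  { rewrite Nat.add_comm, poch_add; f_equal; f_equal; ring. }
  assert (E2 : poch c k * poch (1 * INR k + c) e = poch c e * poch (c + INR e) k).
  { rewrite <- poch_add, (Nat.add_comm e), poch_add; f_equal; f_equal; ring. }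
  assert (E3 : poch (- INR (nu + k)) j * INR (fact k)
     = (-1) ^ nu * INR (fact (nu + k)) * poch (-1 * INR k + 0) (j - nu)).
  { rewrite <- (Nat.add_comm k nu), <- (poch_opp_fact k nu).
    replace j with (nu + (j - nu))%nat at 1 by lia.
    rewrite poch_add; replace (- INR (k + nu) + INR nu) with (-1 * INR k + 0)
      by (rewrite plus_INR; ring).
    ring. }
  assert (poch (a + 1) k <> 0) by (apply poch_neq0; lra).
  assert (poch (a + 1) j <> 0) by (apply poch_neq0; lra).
  assert (poch c k <> 0) by (apply poch_neq0; lra).
  assert (poch c e <> 0) by (apply poch_neq0; lra).
  pose proof (INR_fact_neq_0 k); pose proof (INR_fact_neq_0 n).
  pose proof (INR_fact_neq_0 (nu + k)).
  rewrite E1.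
  replace (poch (c + INR e) k) with (poch c k * poch (1 * INR k + c) e / poch c e)
    by (rewrite E2; field; assumption).
  replace (poch (- INR (nu + k)) j) with
    ((-1) ^ nu * INR (fact (nu + k)) * poch (-1 * INR k + 0) (j - nu) / INR (fact k))
    by (rewrite <- E3; field; assumption).
  field; repeat split; assumption.
- rewrite (finite_difference_eq0 (e + ((j - nu) + (nu + 0))) n G); [ring|unfold e; lia|].
  eapply linear_product_poch; [|reflexivity].
  eapply linear_product_poch; [|reflexivity].
  apply (linear_product_poch 0 nu 1 (a + 1) (fun _ => 1)); [exists 1; auto|].
  intros k; ring.
Qed.

Definition antider (a b : R) (n nu : nat) (y : R) : R :=
  sum_f_R0 (fun k => jac_coef a b n k * (INR (fact k) / INR (fact (k + nu)))
                     * y ^ (k + nu)) n.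

Lemma antider_right_jacobi (a b x : R) (n nu N : nat) :
  -1 < a -> -1 < b -> (n + nu <= N)%nat ->
  antider a b n nu ((1 - x) / 2)
  = sum_f_R0 (fun j => antider_coef a b n nu j * jacobi j a b x) N.
Proof.
intros Ha Hb HN; unfold antider.
transitivity (sum_f_R0 (fun k => sum_f_R0 (fun j =>
  jac_coef a b n k * (INR (fact k) / INR (fact (k + nu)))
  * (pow_coef a b (k + nu) j * jacobi j a b x)) N) n).
- apply sum_eq; intros k Hk.
  rewrite (pow_right_jacobi a b x (k + nu) N), sum_scal_l by (auto; lia); reflexivity.
- rewrite sum_switch; apply sum_eq; intros j _; unfold antider_coef.
  rewrite Rmult_comm, <- sum_scal_l; apply sum_eq; intros k _; ring.
Qed.

(** Reflection exchanges the endpoints, hence the parameters, and contributes [(-1)^j] for each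
    basis element. *)
Lemma antider_left_jacobi (a b x : R) (n nu N : nat) :
  -1 < a -> -1 < b -> (n + nu <= N)%nat ->
  antider b a n nu ((1 + x) / 2)
  = sum_f_R0 (fun j => (-1) ^ j * antider_coef b a n nu j * jacobi j a b x) N.
Proof.
intros Ha Hb HN.
replace ((1 + x) / 2) with ((1 - - x) / 2) by field.
rewrite (antider_right_jacobi b a (- x) n nu N) by assumption.
apply sum_eq; intros j _; rewrite (jacobi_reflect j a b x) by assumption.
transitivity ((-1) ^ j * (-1) ^ j * (antider_coef b a n nu j * jacobi j b a (- x)));
  [rewrite pow_m1_sq|]; ring.
Qed.

Lemma is_derive_sum (f : nat -> R -> R) (d : nat -> R) (x : R) (n : nat) :
  (forall k, is_derive (f k) x (d k)) ->
  is_derive (fun y => sum_f_R0 (fun k => f k y) n) x (sum_f_R0 d n).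
Proof.
intros H; induction n as [|n IH]; simpl; [apply H|].
apply (is_derive_plus (fun y => sum_f_R0 (fun k => f k y) n)); auto.
Qed.

Lemma is_derive_monomial (c : R) (p : nat) (y : R) :
  is_derive (fun y => c * y ^ S p) y (c * INR (S p) * y ^ p).
Proof. auto_derive; [trivial|]; simpl; ring. Qed.

Lemma is_derive_antider (a b : R) (n nu : nat) (y : R) :
  is_derive (antider a b n (S nu)) y (antider a b n nu y).
Proof.
apply (is_derive_sum (fun k y => jac_coef a b n k
  * (INR (fact k) / INR (fact (k + S nu))) * y ^ (k + S nu))); intros k.
rewrite Nat.add_succ_r.
replace (jac_coef a b n k * (INR (fact k) / INR (fact (k + nu))) * y ^ (k + nu))
  with (jac_coef a b n k * (INR (fact k) / INR (fact (S (k + nu))))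
        * INR (S (k + nu)) * y ^ (k + nu)).
- apply is_derive_monomial.
- rewrite fact_simpl, mult_INR; field; split.
  + apply INR_fact_neq_0.
  + apply not_0_INR; lia.
Qed.

Lemma derive_zero_constant (f : R -> R) (x y : R) :
  (forall t, is_derive f t 0) -> f x = f y.
Proof.
intros H; destruct (Rtotal_order x y) as [L|[->|L]]; [|reflexivity|symmetry];
  apply (eq_is_derive f); auto.
Qed.

(** Both sides come from integrating the same polynomial [nu] times, from opposite ends, so they
    differ by a polynomial of degree below [nu]. The sign [(-1)^nu] comes from differentiating
    [1 - y]. *)
Lemma antider_endpoints (a b : R) (n nu : nat) :
  -1 < a -> -1 < b ->
  exists q : nat -> R, (forall i, (nu <= i)%nat -> q i = 0) /\
    forall y, (-1) ^ n * antider b a n nu y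
              = (-1) ^ nu * antider a b n nu (1 - y)
                + sum_f_R0 (fun i => q i * y ^ i) nu.
Proof.
intros Ha Hb; induction nu as [|nu [q [Hq H]]].
- exists (fun _ => 0); split; [auto|]; intros y.
  assert (E : forall a b y, -1 < a -> antider a b n 0 y = jacobi n a b (1 - 2 * y)).
  { clear; intros a b y Ha; rewrite (jacobi_sum n a b _ n) by auto.
    apply sum_eq; intros k _; rewrite Nat.add_0_r.
    replace ((1 - (1 - 2 * y)) / 2) with y by field.
    field; apply INR_fact_neq_0. }
  rewrite !E, (jacobi_reflect n a b) by assumption; simpl.
  replace (- (1 - 2 * (1 - y))) with (1 - 2 * y) by ring; ring.
(* The error [q] is integrated termwise. What remains in [D] is a constant, which becomes the new
   coefficient of [y^0]. *)
- pose (D := fun y => (-1) ^ n * antider b a n (S nu) y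
    - (-1) ^ S nu * antider a b n (S nu) (1 - y)
    - sum_f_R0 (fun i => q i / INR (S i) * y ^ S i) nu).
  assert (HD : forall t, is_derive D t 0).
  { intros t; unfold D.
    replace 0 with ((-1) ^ n * antider b a n nu t
      - (-1) ^ S nu * (-1 * antider a b n nu (1 - t))
      - sum_f_R0 (fun i => q i / INR (S i) * INR (S i) * t ^ i) nu).
    - apply (is_derive_minus (fun y => (-1) ^ n * antider b a n (S nu) y
        - (-1) ^ S nu * antider a b n (S nu) (1 - y))).
      + apply (is_derive_minus (fun y => (-1) ^ n * antider b a n (S nu) y)).
        * apply is_derive_scal, is_derive_antider.
        * apply is_derive_scal.
          apply (is_derive_comp (antider a b n (S nu)) (fun y => 1 - y)).
          -- apply is_derive_antider.
          -- auto_derive; [trivial|ring].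
      + apply (is_derive_sum (fun i y => q i / INR (S i) * y ^ S i)); intros i.
        apply is_derive_monomial.
    - rewrite H; simpl pow.
      rewrite (sum_eq (fun i => q i / INR (S i) * INR (S i) * t ^ i)
                 (fun i => q i * t ^ i)); [ring|].
      intros i _; field; apply not_0_INR; lia. }
  exists (fun i => match i with O => D 0 | S i' => q i' / INR (S i') end); split.
  + intros [|i] Hi; [lia|]; rewrite Hq by lia; unfold Rdiv; ring.
  + intros y; rewrite sum_split_first, (derive_zero_constant D 0 y HD).
    unfold D; simpl pow; ring.
Qed.

(** The two antiderivatives differ by a polynomial of degree less than [nu], which has no component
    along the [j]-th polynomial once [nu <= j]. *)
Lemma antider_coef_reflect (a b : R) (n nu j : nat) :
  -1 < a -> -1 < b -> (nu <= j)%nat ->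
  (-1) ^ (n + j) * antider_coef b a n nu j = (-1) ^ nu * antider_coef a b n nu j.
Proof.
intros Ha Hb Hj; destruct (antider_endpoints a b n nu Ha Hb) as [q [Hq H]].
transitivity ((-1) ^ nu * antider_coef a b n nu j
  + sum_f_R0 (fun i => q i * ((-1) ^ j * pow_coef b a i j)) nu).
- apply (jacobi_coef_unique a b
    (fun j => (-1) ^ (n + j) * antider_coef b a n nu j)
    (fun j => (-1) ^ nu * antider_coef a b n nu j
      (* The upper limit [n + nu + j] bounds the degree of the antiderivatives and also covers the
         index [j]. *)
      + sum_f_R0 (fun i => q i * ((-1) ^ j * pow_coef b a i j)) nu) (n + nu + j));
    [assumption|assumption| |lia].
  intros x; transitivity ((-1) ^ n * antider b a n nu ((1 + x) / 2)).
  + rewrite (antider_left_jacobi a b x n nu (n + nu + j)), <- sum_scal_l by (auto; lia).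
    apply sum_eq; intros i _; rewrite pow_add; ring.
  + rewrite H; replace (1 - (1 + x) / 2) with ((1 - x) / 2) by field.
    rewrite (antider_right_jacobi a b x n nu (n + nu + j)), <- sum_scal_l by (auto; lia).
    transitivity (sum_f_R0 (fun i => (-1) ^ nu * (antider_coef a b n nu i * jacobi i a b x))
                    (n + nu + j)
      + sum_f_R0 (fun l => sum_f_R0 (fun i =>
          q i * ((-1) ^ l * pow_coef b a i l) * jacobi l a b x) nu) (n + nu + j)).
    * f_equal; rewrite sum_switch; apply sum_eq; intros i Hi.
      rewrite (pow_left_jacobi a b x i (n + nu + j)), <- sum_scal_l by (auto; lia).
      apply sum_eq; intros l _; ring.
    * rewrite <- plus_sum; apply sum_eq; intros l _.
      rewrite Rmult_plus_distr_r, (Rmult_comm (sum_f_R0 _ _)), <- sum_scal_l.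
      f_equal; [ring|]; apply sum_eq; intros i _; ring.
- rewrite (sum_eq0 (fun i => q i * ((-1) ^ j * pow_coef b a i j))); [ring|].
  intros i Hi; destruct (Nat.eq_dec i nu) as [->|].
  + rewrite Hq by lia; ring.
  + rewrite pow_coef_gt by lia; ring.
Qed.

(** * Hypergeometric form of the coefficients *)

(** Writing [j = d + nu] and [n = d + K] avoids truncated subtraction. Terms with [k < d] vanish,
    and the shift [k = d + N] turns the rest into a terminating 3F2. *)
Lemma antider_coef_hypergeom (a b : R) (d K nu : nat) :
  -1 < a -> -1 < b ->
  (-1) ^ nu * antider_coef a b (d + K) nu (d + nu)
  = poch (INR d + a + 1) K * poch (INR (d + K) + a + b + 1) d
    / (poch (INR (d + nu) + a + b + 1) (d + nu) * INR (fact K))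
    * hypergeom
        [- INR K; INR (d + nu) + a + 1; INR (d + K) + INR d + a + b + 1]
        [INR d + a + 1; 2 * INR (d + nu) + a + b + 2] 1.
Proof.
intros Ha Hb; unfold antider_coef.
rewrite sum_shift by (intros k Hk; rewrite pow_coef_gt by lia; ring).
rewrite (hypergeom_terminating _ _ _ K) by
  (intros k Hk; simpl; rewrite poch_opp_gt by exact Hk; ring).
rewrite <- !sum_scal_l; apply sum_eq; intros N HN.
unfold jac_coef, pow_coef; cbn [poch_prod fold_right]; rewrite pow1.
set (n := (d + K)%nat); set (j := (d + nu)%nat).
replace (d + N + nu)%nat with (j + N)%nat by (unfold j; lia).
rewrite jac_ratio_shift, jac_ratio_diag by lra.
rewrite (poch_add (- INR n)), (poch_add (INR n + a + b + 1)), (poch_add (a + 1) j).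
rewrite (poch_add (a + 1) d).
replace (poch (a + 1) n) with (poch (a + 1) d * poch (INR d + a + 1) K)
  by (unfold n; rewrite poch_add; f_equal; f_equal; ring).
replace (- INR n + INR d) with (- INR K) by (unfold n; rewrite plus_INR; ring).
replace (INR n + a + b + 1 + INR d) with (INR n + INR d + a + b + 1) by ring.
replace (a + 1 + INR j) with (INR j + a + 1) by ring.
replace (a + 1 + INR d) with (INR d + a + 1) by ring.
replace (INR j + (a + b + 1) + INR j + 1) with (2 * INR j + a + b + 2) by ring.
replace (INR j + (a + b + 1)) with (INR j + a + b + 1) by ring.
pose proof (INR_fact_neq_0 n); pose proof (INR_fact_neq_0 K).
pose proof (INR_fact_neq_0 (d + N)); pose proof (INR_fact_neq_0 N).
pose proof (INR_fact_neq_0 (j + N)).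
pose proof (pos_INR d); pose proof (pos_INR j).
replace (poch (- INR n) d) with ((-1) ^ d * INR (fact n) / INR (fact K)).
2:{ unfold n; rewrite (Nat.add_comm d), <- poch_opp_fact; field; assumption. }
replace (poch (- INR (j + N)) j) with ((-1) ^ j * INR (fact (j + N)) / INR (fact N)).
2:{ rewrite (Nat.add_comm j), <- poch_opp_fact; field; assumption. }
assert (poch (a + 1) d <> 0) by (apply poch_neq0; lra).
assert (poch (a + 1) j <> 0) by (apply poch_neq0; lra).
assert (poch (INR d + a + 1) N <> 0) by (apply poch_neq0; lra).
assert (poch (2 * INR j + a + b + 2) N <> 0) by (apply poch_neq0; lra).
assert (poch (INR j + a + b + 1) j <> 0).
{ destruct j as [|j]; [simpl; lra|apply poch_neq0].
  rewrite S_INR; pose proof (pos_INR j); lra. }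
(* The left side carries the signs of [d], [nu] and [j]. The inserted square of [(-1)^j] absorbs
   them once one copy is split as [j = d + nu]. *)
transitivity ((-1) ^ j * (-1) ^ j * (poch (INR d + a + 1) K * poch (INR n + a + b + 1) d /
  (poch (INR j + a + b + 1) j * INR (fact K)) *
  (poch (- INR K) N *
   (poch (INR j + a + 1) N * (poch (INR n + INR d + a + b + 1) N * 1)) /
   (poch (INR d + a + 1) N * (poch (2 * INR j + a + b + 2) N * 1)) *
   (1 / INR (fact N))))); [|rewrite pow_m1_sq; ring].
replace ((-1) ^ j) with ((-1) ^ d * (-1) ^ nu) at 2 by (unfold j; rewrite pow_add; ring).
field; repeat split; assumption.
Qed.

(** The factor shared by [varpi] and [dcoef] at [nu = k + 1]: the coefficient of [((1 + x) / 2)^k]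
    times [k!]. *)
Lemma jac_coef_lead (a b : R) (m k : nat) :
  -1 < a -> -1 < b -> (k <= m)%nat ->
  (-1) ^ m * jac_coef b a m k * INR (fact k)
  = (-1) ^ (m + k) * poch (b + INR (S k)) (m - k) * poch (INR m + a + b + 1) k
    / INR (fact (m - k)).
Proof.
intros Ha Hb Hk; unfold jac_coef.
replace (poch (b + 1) m) with (poch (b + 1) k * poch (b + INR (S k)) (m - k)).
2:{ replace m with (k + (m - k))%nat at 2 by lia.
    rewrite poch_add, S_INR; f_equal; f_equal; ring. }
replace (poch (- INR m) k) with ((-1) ^ k * INR (fact m) / INR (fact (m - k))).
2:{ pose proof (poch_opp_fact (m - k) k) as F; rewrite Nat.sub_add in F by exact Hk.
    rewrite <- F; field; apply INR_fact_neq_0. }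
replace (INR m + b + a + 1) with (INR m + a + b + 1) by ring.
rewrite pow_add.
assert (poch (b + 1) k <> 0) by (apply poch_neq0; lra).
pose proof (INR_fact_neq_0 m); pose proof (INR_fact_neq_0 k).
pose proof (INR_fact_neq_0 (m - k)); field; repeat split; assumption.
Qed.

Lemma varpi_antider_coef (a b : R) (m n j k : nat) :
  -1 < a -> -1 < b -> (k <= m)%nat -> (S k <= j)%nat -> (j <= n + S k)%nat ->
  varpi m n j (S k) a b
  = 2 * ((-1) ^ m * jac_coef b a m k * INR (fact k))
    * ((-1) ^ S k * antider_coef a b n (S k) j).
Proof.
intros Ha Hb Hk Hj Hn.
pose (d := (j - S k)%nat); pose (K := (n + S k - j)%nat).
replace n with (d + K)%nat by (unfold d, K; lia).
replace j with (d + S k)%nat by (unfold d; lia).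
clearbody d K; clear j n Hj Hn.
rewrite antider_coef_hypergeom, jac_coef_lead by assumption; unfold varpi.
replace (m + S k - 1)%nat with (m + k)%nat by lia.
replace (m + 1 - S k)%nat with (m - k)%nat by lia.
replace (d + K + S k - (d + S k))%nat with K by lia.
replace (d + S k - S k)%nat with d by lia.
replace (S k - 1)%nat with k by lia.
replace (INR (d + S k) - INR (S k) + a + 1) with (INR d + a + 1)
  by (rewrite (plus_INR d (S k)); ring).
replace (INR (d + S k) - INR (d + K) - INR (S k)) with (- INR K)
  by (rewrite !plus_INR; ring).
replace (INR (d + K) + INR (d + S k) - INR (S k) + a + b + 1)
  with (INR (d + K) + INR d + a + b + 1) by (rewrite (plus_INR d (S k)); ring).
unfold Rdiv; rewrite !Rinv_mult; ring.
Qed.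

(** Since [j < nu], no term of the antiderivative coefficient drops out and no index shift occurs.
    The parameter 1 of the 4F3 supplies [l!] against the series factorial, and [nu - j + 1] comes
    from [(-(l+nu))_j / (l+nu)!]. *)
Lemma dcoef_antider_coef (a b : R) (m n j k : nat) :
  -1 < a -> -1 < b -> (k <= n)%nat -> (j <= k)%nat -> (j <= m)%nat ->
  dcoef m n (S k) j a b
  = 2 * ((-1) ^ n * jac_coef b a n k * INR (fact k))
    * ((-1) ^ (m + j) * antider_coef b a m (S k) j).
Proof.
intros Ha Hb Hk Hjk Hjm; rewrite jac_coef_lead by assumption.
unfold dcoef, antider_coef; rewrite dratio_jac_ratio by assumption.
rewrite (hypergeom_terminating _ _ _ m) by
  (intros i Hi; simpl; rewrite (poch_opp_gt m) by exact Hi; ring).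
rewrite <- !sum_scal_l; apply sum_eq; intros l Hl.
unfold jac_coef, pow_coef; cbn [poch_prod fold_right]; rewrite pow1.
replace (l + S k)%nat with (S k + l)%nat by lia.
rewrite jac_ratio_shift by lra.
replace (b + a + 1) with (a + b + 1) by ring.
set (w := jac_ratio (a + b + 1) (S k) j).
replace (S k - 1)%nat with k by lia.
replace (n + 1 - S k)%nat with (n - k)%nat by lia.
replace (INR m + b + a + 1) with (INR m + a + b + 1) by ring.
replace (INR n + 1 + a + b) with (INR n + a + b + 1) by ring.
replace (INR j + a + b + INR (S k) + 2) with (INR j + (a + b + 1) + INR (S k) + 1) by ring.
pose (p := (S k - j)%nat).
replace (INR (S k) - INR j + 1) with (INR p + 1) by (unfold p; rewrite minus_INR by lia; ring).
fold p.
replace (poch (- INR (S k + l)) j)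
  with ((-1) ^ j * INR (fact (S k + l)) / (INR (fact p) * poch (INR p + 1) l)).
2:{ rewrite <- fact_add; replace (S k + l)%nat with (p + l + j)%nat by (unfold p; lia).
    rewrite <- poch_opp_fact; field; apply INR_fact_neq_0. }
assert (E1 : poch 1 l = INR (fact l)).
{ change l with (0 + l)%nat at 2; rewrite fact_add; simpl (INR 0).
  replace (0 + 1) with 1 by ring; simpl; ring. }
assert (E2 : poch (b + 1) m = poch (b + 1) j * poch (INR j + b + 1) (m - j)).
{ replace m with (j + (m - j))%nat at 1 by lia.
  rewrite poch_add; f_equal; f_equal; ring. }
assert (E3 : poch (b + 1) n = poch (b + 1) k * poch (b + INR (S k)) (n - k)).
{ replace n with (k + (n - k))%nat at 1 by lia.
  rewrite poch_add, S_INR; f_equal; f_equal; ring. }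
assert (E4 : poch (b + 1) (S k + l)
  = poch (b + 1) k * (b + INR (S k)) * poch (b + INR (S k) + 1) l).
{ rewrite poch_add; simpl (poch (b + 1) (S k)); rewrite S_INR.
  f_equal; [ring|f_equal; ring]. }
rewrite E1, E2, E3, E4.
replace (m + n + 1 + S k)%nat with (m + n + (k + 2))%nat by lia.
rewrite !pow_add; replace ((-1) ^ 2) with 1 by ring.
pose proof (pos_INR j); pose proof (pos_INR p).
pose proof (pos_INR k); pose proof (pos_INR l).
pose proof (INR_fact_neq_0 l); pose proof (INR_fact_neq_0 m).
pose proof (INR_fact_neq_0 (S k + l)); pose proof (INR_fact_neq_0 p).
pose proof (INR_fact_neq_0 (n - k)).
assert (poch (b + 1) l <> 0) by (apply poch_neq0; lra).
assert (poch (b + 1) j <> 0) by (apply poch_neq0; lra).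
assert (poch (INR p + 1) l <> 0) by (apply poch_neq0; lra).
assert (poch (INR j + (a + b + 1) + INR (S k) + 1) l <> 0)
  by (apply poch_neq0; rewrite S_INR; lra).
transitivity ((-1) ^ j * (-1) ^ j * (
  2 * ((-1) ^ m * (-1) ^ n * (-1) ^ k) * w * (b + INR (S k)) *
 poch (INR j + b + 1) (m - j) * (poch (b + 1) k * poch (b + INR (S k)) (n - k)) *
 poch (INR n + a + b + 1) k / (INR (fact m) * INR (fact (n - k)) * INR (fact p)) *
 (poch (- INR m) l * poch (b + INR (S k) + 1) l * poch (INR m + a + b + 1) l /
  (poch (INR p + 1) l * poch (b + 1) l * poch (INR j + (a + b + 1) + INR (S k) + 1) l)))).
- rewrite pow_m1_sq; field; repeat split; assumption.
- field; repeat split; assumption.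
Qed.

(** * The beta integral and the convolution *)

(** Integration of the derivative of [(c - t)^k (t - d)^(l+1)]. At [k = 0] the truncated [pred k] is
    harmless, its factor [INR k] being zero. *)
Lemma is_RInt_beta_parts (c d : R) (k l : nat) :
  is_RInt (fun t => INR (S l) * ((c - t) ^ k * (t - d) ^ l)
                    - INR k * ((c - t) ^ pred k * (t - d) ^ S l)) d c
    ((c - c) ^ k * (c - d) ^ S l).
Proof.
replace ((c - c) ^ k * (c - d) ^ S l)
  with (minus ((c - c) ^ k * (c - d) ^ S l) ((c - d) ^ k * (d - d) ^ S l))
  by (unfold minus, plus, opp; simpl; ring).
apply (is_RInt_derive (fun t => (c - t) ^ k * (t - d) ^ S l)).
- intros t _; auto_derive; [trivial|].
  change (match l with O => 1 | S _ => INR l + 1 end) with (INR (S l)).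
  simpl; unfold Rminus; ring.
- intros t _; apply (ex_derive_continuous (fun t =>
    INR (S l) * ((c - t) ^ k * (t - d) ^ l)
    - INR k * ((c - t) ^ pred k * (t - d) ^ S l))).
  auto_derive; trivial.
Qed.

(** Integration by parts trades one power of [c - t] for one of [t - d], so the induction on [k]
    runs over all [l]. The integral is oriented and includes [c < d], which occurs when
    [x + 1 < -1]. *)
Lemma is_RInt_beta (c d : R) (k l : nat) :
  is_RInt (fun t => (c - t) ^ k * (t - d) ^ l) d c
    (INR (fact k) * INR (fact l) / INR (fact (k + l + 1)) * (c - d) ^ (k + l + 1)).
Proof.
revert l; induction k as [|k IH]; intros l; pose proof (is_RInt_beta_parts c d) as P.
- specialize (P O l); apply (is_RInt_scal _ _ _ (/ INR (S l))) in P.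
  assert (INR (S l) <> 0) by (apply not_0_INR; lia).
  pose proof (INR_fact_neq_0 l).
  replace (INR (fact 0) * INR (fact l) / INR (fact (0 + l + 1)) * (c - d) ^ (0 + l + 1))
    with (scal (/ INR (S l)) ((c - c) ^ 0 * (c - d) ^ S l)).
  + eapply is_RInt_ext; [|exact P]; intros t _; unfold scal; cbn -[INR].
    unfold mult; cbn -[INR]; change (INR 0) with 0; field; assumption.
  + replace (0 + l + 1)%nat with (S l) by lia.
    rewrite fact_simpl, mult_INR; change (INR (fact 0)) with 1.
    unfold scal; cbn -[INR pow fact]; unfold mult; cbn -[INR pow fact].
    change ((c - c) ^ 0) with 1; field; auto.
- specialize (P (S k) l); specialize (IH (S l)).
  apply (is_RInt_scal _ _ _ (INR (S k))) in IH.
  pose proof (is_RInt_plus _ _ _ _ _ _ P IH) as Q.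
  apply (is_RInt_scal _ _ _ (/ INR (S l))) in Q.
  assert (INR (S l) <> 0) by (apply not_0_INR; lia).
  pose proof (INR_fact_neq_0 l); pose proof (INR_fact_neq_0 k).
  pose proof (INR_fact_neq_0 (S k + l + 1)).
  match type of Q with is_RInt _ _ _ ?v => replace
    (INR (fact (S k)) * INR (fact l) / INR (fact (S k + l + 1)) * (c - d) ^ (S k + l + 1))
    with v end.
  + eapply is_RInt_ext; [|exact Q]; intros t _.
    unfold scal, plus; cbn -[INR pow]; unfold mult; cbn -[INR pow pred].
    change (pred (S k)) with k; field; assumption.
  + unfold scal, plus; cbn -[INR pow fact Nat.add]; unfold mult; cbn -[INR pow fact Nat.add].
    replace (k + S l + 1)%nat with (S k + l + 1)%nat by lia.
    rewrite (fact_simpl k), (fact_simpl l), !mult_INR.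
    replace (c - c) with 0 by ring; rewrite pow_i by lia; field; auto.
Qed.

Lemma is_RInt_sum (f : nat -> R -> R) (v : nat -> R) (c d : R) (n : nat) :
  (forall k, is_RInt (f k) c d (v k)) ->
  is_RInt (fun t => sum_f_R0 (fun k => f k t) n) c d (sum_f_R0 v n).
Proof.
intros H; induction n as [|n IH]; simpl; [apply H|].
apply (is_RInt_plus (fun t => sum_f_R0 (fun k => f k t) n)); auto.
Qed.

Lemma jacobi_left_sum (n : nat) (a b x : R) :
  -1 < a -> -1 < b ->
  jacobi n a b x
  = sum_f_R0 (fun k => (-1) ^ n * jac_coef b a n k * ((1 + x) / 2) ^ k) n.
Proof.
intros Ha Hb; rewrite jacobi_reflect, (jacobi_sum n b a _ n), <- sum_scal_l by auto.
apply sum_eq; intros k _; replace (1 - - x) with (1 + x) by ring; ring.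
Qed.

(** About the left endpoint the two factors are polynomials in [1 + (x - t) = (x + 1) - t] and
    [1 + t], so each product of monomials is a beta integral. *)
Lemma RInt_jacobi_conv (a b : R) (m n : nat) (x : R) :
  -1 < a -> -1 < b ->
  RInt (fun t => jacobi m a b (x - t) * jacobi n a b t) (-1) (x + 1)
  = sum_f_R0 (fun k => sum_f_R0 (fun l =>
      2 * ((-1) ^ m * jac_coef b a m k * INR (fact k))
        * ((-1) ^ n * jac_coef b a n l * INR (fact l))
      / INR (fact (k + l + 1)) * ((1 + (x + 1)) / 2) ^ (k + l + 1)) n) m.
Proof.
intros Ha Hb; apply is_RInt_unique.
pose (M := fun k => (-1) ^ m * jac_coef b a m k / 2 ^ k).
pose (N := fun l => (-1) ^ n * jac_coef b a n l / 2 ^ l).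
apply (is_RInt_ext (fun t => sum_f_R0 (fun k => sum_f_R0 (fun l =>
  scal (M k * N l) ((x + 1 - t) ^ k * (t - -1) ^ l)) n) m)).
- intros t _; rewrite (jacobi_left_sum m a b), (jacobi_left_sum n a b) by assumption.
  rewrite Rmult_comm, <- sum_scal_l; apply sum_eq; intros k _.
  rewrite Rmult_comm, <- sum_scal_l; apply sum_eq; intros l _.
  unfold scal; simpl; unfold mult; simpl; unfold M, N, Rdiv.
  rewrite !Rpow_mult_distr, !pow_inv.
  replace (1 + (x - t)) with (x + 1 - t) by ring.
  replace (1 + t) with (t - -1) by ring; ring.
- apply is_RInt_sum; intros k; apply is_RInt_sum; intros l.
  replace (2 * ((-1) ^ m * jac_coef b a m k * INR (fact k))
        * ((-1) ^ n * jac_coef b a n l * INR (fact l))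
      / INR (fact (k + l + 1)) * ((1 + (x + 1)) / 2) ^ (k + l + 1))
    with (scal (M k * N l) (INR (fact k) * INR (fact l) / INR (fact (k + l + 1))
            * (x + 1 - -1) ^ (k + l + 1))).
  + apply (is_RInt_scal (fun t => (x + 1 - t) ^ k * (t - -1) ^ l)), is_RInt_beta.
  + unfold scal; simpl scal; unfold mult; cbn -[INR pow fact Nat.add]; unfold M, N.
    replace ((1 + (x + 1)) / 2) with ((x + 1 - -1) * / 2) by field.
    rewrite Rpow_mult_distr, pow_inv, !pow_add, !pow_1.
    assert (2 ^ k <> 0) by (apply pow_nonzero; lra).
    assert (2 ^ l <> 0) by (apply pow_nonzero; lra).
    pose proof (INR_fact_neq_0 (k + l + 1)); field; auto.
Qed.

(** * Coefficients of the convolution *)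

(** The share of the [k]-th power in [P_m] in the coefficient of the [j]-th polynomial. *)
Definition conv_coef (a b : R) (m n k j : nat) : R :=
  2 * ((-1) ^ m * jac_coef b a m k * INR (fact k))
  * ((-1) ^ (n + j) * antider_coef b a n (S k) j).

Lemma conv_expansion (a b : R) (m n : nat) (x : R) :
  -1 < a -> -1 < b ->
  sum_f_R0 (fun k => sum_f_R0 (fun l =>
      2 * ((-1) ^ m * jac_coef b a m k * INR (fact k))
        * ((-1) ^ n * jac_coef b a n l * INR (fact l))
      / INR (fact (k + l + 1)) * ((1 + x) / 2) ^ (k + l + 1)) n) m
  = sum_f_R0 (fun j => sum_f_R0 (fun k => conv_coef a b m n k j) m * jacobi j a b x)
      (m + n + 1).
Proof.
intros Ha Hb.
transitivity (sum_f_R0 (fun k => sum_f_R0 (fun j =>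
  conv_coef a b m n k j * jacobi j a b x) (m + n + 1)) m).
- apply sum_eq; intros k Hk.
  (* For fixed [k] the sum over [l] is a [(k + 1)]-fold antiderivative from the left endpoint. *)
  transitivity (2 * ((-1) ^ m * jac_coef b a m k * INR (fact k)) * (-1) ^ n
    * antider b a n (S k) ((1 + x) / 2)).
  + unfold antider; rewrite <- sum_scal_l; apply sum_eq; intros l _.
    replace (k + l + 1)%nat with (l + S k)%nat by lia; unfold Rdiv; ring.
  + rewrite (antider_left_jacobi a b x n (S k) (m + n + 1)), <- sum_scal_l
      by (auto; lia).
    apply sum_eq; intros j _; unfold conv_coef; rewrite pow_add; ring.
- rewrite sum_switch; apply sum_eq; intros j _.
  rewrite Rmult_comm, <- sum_scal_l; apply sum_eq; intros k _; ring.
Qed.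

Lemma RInt_jacobi_expansion (a b : R) (m n : nat) (x : R) :
  -1 < a -> -1 < b ->
  RInt (fun t => jacobi m a b (x - t) * jacobi n a b t) (-1) (x + 1)
  = sum_f_R0 (fun j => sum_f_R0 (fun k => conv_coef a b m n k j) m
                       * jacobi j a b (x + 1)) (m + n + 1).
Proof. intros Ha Hb; rewrite RInt_jacobi_conv, conv_expansion by assumption; reflexivity. Qed.

(** The double sum over monomials is symmetric in the two polynomials; uniqueness of Jacobi
    coefficients carries the symmetry over to the totals. *)
Lemma conv_coef_sym (a b : R) (m n j : nat) :
  -1 < a -> -1 < b -> (j <= m + n + 1)%nat ->
  sum_f_R0 (fun k => conv_coef a b m n k j) m
  = sum_f_R0 (fun k => conv_coef a b n m k j) n.
Proof.
intros Ha Hb; apply (jacobi_coef_unique a b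
  (fun j => sum_f_R0 (fun k => conv_coef a b m n k j) m)
  (fun j => sum_f_R0 (fun k => conv_coef a b n m k j) n)); [assumption..|]; intros x.
rewrite <- conv_expansion by assumption.
rewrite (Nat.add_comm m n), <- conv_expansion, sum_switch by assumption.
apply sum_eq; intros l _; apply sum_eq; intros k _.
rewrite (Nat.add_comm k l); unfold Rdiv; ring.
Qed.

(** * The three ranges of [j] *)

Lemma sum_n_m_succ (f : nat -> R) (n : nat) :
  sum_n_m f 1 (S n) = sum_f_R0 (fun k => f (S k)) n.
Proof. rewrite <- sum_n_m_S; apply sum_n_Reals. Qed.

Lemma sum_n_m_trim (f : nat -> R) (lo n : nat) :
  (1 <= lo)%nat -> (lo <= S n)%nat ->
  (forall nu, (1 <= nu < lo)%nat -> f nu = 0) ->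
  sum_n_m f lo n = sum_n_m f 1 n.
Proof.
intros Hlo; induction Hlo as [|lo Hlo IH]; intros Hn H; [reflexivity|].
rewrite <- IH by (intros; try apply H; lia).
rewrite (sum_Sn_m f lo n) by lia; rewrite H by lia; symmetry; exact (Rplus_0_l _).
Qed.

Lemma conv_coef_varpi (a b : R) (m n k j : nat) :
  -1 < a -> -1 < b -> (k <= m)%nat -> (S k <= j)%nat -> (j <= n + S k)%nat ->
  conv_coef a b m n k j = varpi m n j (S k) a b.
Proof.
intros; rewrite varpi_antider_coef by assumption; unfold conv_coef.
rewrite antider_coef_reflect by assumption; reflexivity.
Qed.

Lemma conv_coef_eq0 (a b : R) (m n k j : nat) :
  -1 < a -> -1 < b -> (S k <= j)%nat -> (j + S k < n \/ n + S k < j)%nat ->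
  conv_coef a b m n k j = 0.
Proof.
intros Ha Hb Hk [H|H]; unfold conv_coef.
- rewrite antider_coef_reflect, antider_coef_lt by assumption; ring.
- rewrite antider_coef_gt by exact H; ring.
Qed.

Theorem theorem3p4 :
  forall (alpha beta : R) (m n : nat),
    -1 < alpha -> -1 < beta -> (1 <= m)%nat -> (1 <= n)%nat -> (m <= n)%nat ->
    (exists rho : nat -> R, is_convolution_expansion alpha beta m n rho) /\
    (forall rho : nat -> R,
       is_convolution_expansion alpha beta m n rho ->
       (forall j : nat,
          (Nat.max (m + 1) (n - m - 1) <= j <= m + n + 1)%nat ->
          rho j = sum_n_m (fun nu => varpi m n j nu alpha beta)
                    (Nat.max 1 (abs_diff j n)) (m + 1)) /\
       ((2 * m + 3 <= n)%nat ->
        forall j : nat, (m + 1 <= j <= n - m - 2)%nat -> rho j = 0) /\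
       (forall j : nat, (j <= m)%nat ->
          rho j = sum_n_m (fun nu => varpi n m j nu alpha beta) 1 j
                  + sum_n_m (fun nu => dcoef m n nu j alpha beta)
                      (j + 1) (n + 1))).
Proof.
intros a b m n Ha Hb _ _ Hmn; split.
{ exists (fun j => sum_f_R0 (fun k => conv_coef a b m n k j) m); intros x.
  rewrite RInt_jacobi_expansion by assumption; symmetry; apply sum_n_Reals. }
intros rho Hrho.
assert (E : forall j, (j <= m + n + 1)%nat ->
  rho j = sum_f_R0 (fun k => conv_coef a b m n k j) m).
{ apply (jacobi_coef_unique a b rho
    (fun j => sum_f_R0 (fun k => conv_coef a b m n k j) m)); [assumption..|]; intros x.
  (* The expansion is stated at [x + 1], whereas uniqueness is applied at [x]. *)
  replace x with (x - 1 + 1) by ring.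
  rewrite <- RInt_jacobi_expansion, Hrho by assumption; symmetry; apply sum_n_Reals. }
repeat split.
- intros j Hj; rewrite E by lia.
  assert (Hd : abs_diff j n = Nat.max (j - n) (n - j)) by (unfold abs_diff; lia).
  rewrite Hd, Nat.add_1_r.
  rewrite (sum_n_m_ext_loc _ (fun nu => conv_coef a b m n (pred nu) j)).
  (* Terms with [nu < |j - n|] have [j + nu < n] or [n + nu < j], so they vanish and the lower limit
     may drop to 1. *)
  + rewrite sum_n_m_trim, sum_n_m_succ; [reflexivity|lia|lia|].
    intros nu Hnu; apply conv_coef_eq0; [assumption..|lia|lia].
  + intros [|k] Hk; [lia|]; symmetry; apply conv_coef_varpi; [assumption..|lia|lia|lia].
(* Every [nu <= m + 1] satisfies both [nu <= j] and [j + nu < n] here. *)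
- intros Hn j Hj; rewrite E by lia; apply sum_eq0; intros k Hk.
  apply conv_coef_eq0; [assumption..|lia|lia].
(* With [m] and [n] exchanged, [nu] runs up to [n + 1]. The split at [nu = j] separates the terms in
   3F2 form from those in 4F3 form. *)
- intros j Hj; rewrite E, conv_coef_sym by (auto; lia).
  rewrite <- (sum_n_m_succ (fun nu => conv_coef a b n m (pred nu) j)).
  rewrite (sum_n_m_Chasles _ 1 j (S n)) by lia; rewrite !Nat.add_1_r.
  apply (f_equal2 Rplus); apply sum_n_m_ext_loc; intros [|k] Hk; try lia; simpl pred.
  + apply conv_coef_varpi; [assumption..|lia|lia|lia].
  + rewrite dcoef_antider_coef by (auto; lia); reflexivity.
Qed.
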